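(* Let $m\geq 3$ be an integer, let $\beta>1$ be the (larger) root of $x^2-mx+1$, and let $\mathbb{Z}_{-\beta}=\{t_j\mid j\in\mathbb{Z}\}$ with $t_0=0$ and $t_j<t_{j+1}$ for all $j$. Put $\eta=1-\frac1\beta$. Then for all $j,k\in\mathbb{Z}$, $$t_j+t_k\in t_{j+k}+\{-\eta,0,\eta\}\qquad\text{and}\qquad t_j-t_k\in t_{j-k}+\{-\eta,0,\eta\}.$$
   Context: **$(-\beta)$-integers.** For $\beta>1$ let $l=-\frac{\beta}{\beta+1}$, $I=[l,l+1)$, $T(x)=-\beta x-\lfloor-\beta x-l\rfloor$ on $I$, and for $x\in I$ put $d_{-\beta}(x)=y_1y_2y_3\cdots$ with $y_i=\lfloor-\beta T^{i-1}(x)-l\rfloor$. For $x\in\mathbb{R}$ choose an integer $k\geq 0$ with $x/(-\beta)^k\in(l,l+1)$; if $d_{-\beta}(x/(-\beta)^k)=y_1y_2\cdots$, then $x\in\mathbb{Z}_{-\beta}$ if and only if $y_i=0$ for all $i>k$ (this does not depend on the choice of $k$). *)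

(* Defs.v *)
From mathcomp Require Export all_boot all_order all_algebra.
From mathcomp Require Export all_classical all_reals.
Set Implicit Arguments.
Unset Strict Implicit.
Unset Printing Implicit Defensive.
Import Order.TTheory GRing.Theory Num.Theory.
Local Open Scope classical_set_scope.
Local Open Scope ring_scope.

Definition nb_l (R : realType) (beta : R) : R := - (beta / (beta + 1)).

(* Total function; for 1 < beta it maps the interval [l, l + 1) to itself, and
   only its iterates on that interval matter. *)
Definition nb_T (R : realType) (beta x : R) : R :=
  - beta * x - (Num.floor (- beta * x - nb_l beta))%:~R.

(* Digits are numbered from 1, as in y_1 y_2 y_3 ...; index 0 is never used. *)
Definition nb_digit (R : realType) (beta x : R) (i : nat) : int :=
  Num.floor (- beta * iter i.-1 (nb_T beta) x - nb_l beta).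

(* Every x admits some k with x / (- beta)^k in (l, l + 1), and the digit
   condition does not depend on which one is taken, so "choose k" is rendered
   by an existential quantifier. *)
Definition nb_integers (R : realType) (beta : R) : set R :=
  [set x | exists k : nat,
     nb_l beta < x / (- beta) ^+ k < nb_l beta + 1 /\
     forall i : nat, (k < i)%N -> nb_digit beta (x / (- beta) ^+ k) i = 0].

(* Main.v *)
Require Import Defs.
From mathcomp Require Import zify ring lra.
Set Implicit Arguments.
Unset Strict Implicit.
Import Order.TTheory GRing.Theory Num.Theory.
Local Open Scope classical_set_scope.
Local Open Scope ring_scope.

(** Write eta = 1 - 1/beta. Since 1/beta is the algebraic conjugate of beta, the
    conjugate of a + b eta (a, b integers) is a - b (beta - 1). The digit
    restrictions of the (-beta)-expansion say exactly that x in Z[beta] is a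
    (-beta)-integer iff its conjugate lies in the window
    [2/(beta+1) - 1, 2/(beta+1) - 1 + (beta - 1)). That window has length
    beta - 1, so each integer p has exactly one partner
    q(p) = floor(p/(beta-1) + 1/(beta+1)) with p + q(p) eta in Z_{-beta}; as q is
    nondecreasing, t_p = p + q(p) eta. Rounding then gives
    q(j) + q(k) - q(j + k) and q(j) - q(k) - q(j - k) in {-1, 0, 1}. *)

(** * Conjugates along orbits of the transformation T *)

Definition conj_lo (R : realType) (beta : R) : R := 2 * (beta + 1)^-1 - 1.
Definition conj_hi (R : realType) (beta : R) : R := conj_lo beta + (beta - 1).

(* Holds for z = T^k(y) and w the conjugate of (-beta)^k y - T^k(y). The third
   clause encodes that the digit m - 1 is never followed by 0: after the digit
   m - 1 one has z <= T(l) = 1/(beta+1) - 1/beta, and for such z the next digit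
   is positive. *)
Definition nb_domain (R : realType) (beta z w : R) : Prop :=
  [/\ nb_l beta <= z < nb_l beta + 1,
      conj_lo beta < w < conj_hi beta + 1
    & (beta + 1)^-1 - beta^-1 < z -> w < conj_hi beta].

Definition nb_val (R : realType) (beta : R) (a b : int) : R :=
  a%:~R + b%:~R * (1 - beta^-1).

Definition nb_conj (R : realType) (beta : R) (a b : int) : R :=
  a%:~R - b%:~R * (beta - 1).

Lemma nb_lE (R : realType) (beta : R) :
  1 < beta -> nb_l beta = (beta + 1)^-1 - 1.
Proof.
move=> b1; rewrite /nb_l.
by field; apply: lt0r_neq0; lra.
Qed.

Lemma beta_inv_facts (R : realType) (beta : R) : 1 < beta ->
  [/\ 0 < (beta + 1)^-1, (beta + 1)^-1 < 2^-1,
      (beta + 1)^-1 < beta^-1, beta^-1 < 1 &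
      [/\ beta * beta^-1 = 1, beta * (beta + 1)^-1 = 1 - (beta + 1)^-1 &
      beta^-1 * (beta + 1)^-1 = beta^-1 - (beta + 1)^-1]].
Proof.
move=> b1.
have b0 : beta != 0 by apply: lt0r_neq0; lra.
have b10 : beta + 1 != 0 by apply: lt0r_neq0; lra.
split; last by split; field; rewrite ?b0 ?b10.
- by rewrite invr_gt0; lra.
- by rewrite ltf_pV2 ?posrE; lra.
- by rewrite ltf_pV2 ?posrE; lra.
- by rewrite invf_lt1; lra.
Qed.

Lemma nb_T_itv (R : realType) (beta z : R) :
  nb_l beta <= nb_T beta z < nb_l beta + 1.
Proof.
rewrite /nb_T; have := floor_itv (- beta * z - nb_l beta); rewrite intrD.
by lra.
Qed.

(** The digit d satisfies 0 <= d <= m - 1. The upper bound on d - w/beta follows from w > [conj_lo];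
    the lower one is critical only for d = 0, where the third clause of [nb_domain] is used. *)
Lemma nb_domain_step (R : realType) (m : int) (beta z w : R) :
  1 < beta -> beta + beta^-1 = m%:~R -> nb_domain beta z w ->
  nb_domain beta (nb_T beta z)
    ((Num.floor (- beta * z - nb_l beta))%:~R - beta^-1 * w).
Proof.
move=> b1 bm [z_itv w_itv zw]; split; [exact: nb_T_itv| |].
all: move: z_itv w_itv zw; rewrite /nb_T /conj_hi /conj_lo nb_lE //.
all: have [c0 c2 cg g1 [bg bc gc]] := beta_inv_facts b1.
all: set d := Num.floor _; have := floor_itv (- beta * z - ((beta + 1)^-1 - 1)).
all: rewrite -/d intrD; move: d => d /andP[dle dlt] /andP[zl zu] /andP[wl wu] zw.
all: set c := (beta + 1)^-1 in c0 c2 cg bc gc dle dlt zl zu wl wu zw *.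
all: set g := beta^-1 in bm cg g1 bg gc zw *.
all: have bz1 : beta * z < 1 - c by rewrite -bc ltr_pM2l; lra.
all: have bz2 : 1 - c - beta <= beta * z by nra.
all: have d0 : (0 <= d) by rewrite -ltzD1 -(ltr_int R) intrD; lra.
all: have dm : (d <= m - 1) by rewrite -ltzD1 subrK -(ltr_int R); lra.
all: have gw1 : g - 2 * c < - (- g * w) by nra.
all: have d0R : 0 <= d%:~R :> R by rewrite ler0z.
all: have dmR : d%:~R <= m%:~R - 1 :> R by rewrite -(intrB _ m 1) ler_int.
- apply/andP; split; last by nra.
  (* Either [zw] sharpens the bound on [w], or -beta z - l >= 1 and the digit is positive. *)
  have [zt|zt] := ltP (c - g) z; first by have := zw zt; nra.
  have d1 : (1 <= d) by rewrite -ltzD1 -(ltr_int R) intrD; nra.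
  have : 1 <= d%:~R :> R by rewrite -[1]/(1%:~R) ler_int.
  by nra.
- move=> Tz.
  (* As z >= l, having T(z) > c - g forces d < beta - 1 + 1/beta = m - 1. *)
  have dm2 : (d <= m - 2) by rewrite -ltzD1 -(ltr_int R) intrD intrB; lra.
  have : d%:~R <= m%:~R - 2 :> R by rewrite -(intrB _ m 2) ler_int.
  by lra.
Qed.

(* Multiplication by - beta is computed in the basis (1, eta) using
   beta = m - 1 + eta; on conjugates it becomes multiplication by - 1/beta. *)
Lemma nb_val_step (R : realType) (m : int) (beta : R) (a b d : int) :
  1 < beta -> beta + beta^-1 = m%:~R ->
  exists a' b' : int,
    nb_val beta a' b' = d%:~R - beta * nb_val beta a b /\
    nb_conj beta a' b' = d%:~R - beta^-1 * nb_conj beta a b.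
Proof.
move=> b1 bm; have [_ _ _ _ [bg _ _]] := beta_inv_facts b1.
exists (d + (1 - m) * a + (2 - m) * b), (- a - b).
rewrite /nb_val /nb_conj !(intrD, intrB, intrM, intrN) -bm.
by split; ring: bg.
Qed.

(** Induction on [k], starting from the conjugate 0, which lies inside the window. *)
Lemma nb_orbit (R : realType) (m : int) (beta y : R) (k : nat) :
  1 < beta -> beta + beta^-1 = m%:~R -> nb_l beta < y < nb_l beta + 1 ->
  exists a b : int,
    (- beta) ^+ k * y = nb_val beta a b + iter k (nb_T beta) y /\
    nb_domain beta (iter k (nb_T beta) y) (nb_conj beta a b).
Proof.
move=> b1 bm y_itv; have [c0 c2 cg g1 [_ bc _]] := beta_inv_facts b1.
elim: k => [|k [a [b [IH dom]]]].
  exists 0, 0; rewrite expr0 /nb_val /nb_conj /= !mulr0z !mul0r subr0.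
  split; first by ring.
  split=> [||_]; rewrite /conj_hi /conj_lo.
  - by lra.
  - by lra.
  - by nra.
set z := iter k _ y in IH dom.
have [a' [b' [va' co']]] :=
  nb_val_step a b (Num.floor (- beta * z - nb_l beta)) b1 bm.
exists a', b'; split; last first.
  by rewrite co' iterS -/z; exact: (nb_domain_step b1 bm dom).
by rewrite va' exprS -mulrA IH iterS -/z /nb_T; ring.
Qed.

Lemma intr_leN1 (R : numDomainType) (p : int) : p < 0 -> p%:~R <= -1 :> R.
Proof. by rewrite -[-1]/((-1)%:~R) ler_int; lia. Qed.

Lemma intr_ge1 (R : numDomainType) (p : int) : 0 < p -> 1 <= p%:~R :> R.
Proof. by rewrite -[1]/(1%:~R) ler_int; lia. Qed.

Lemma intr_ge0 (R : numDomainType) (p : int) : -1 < p -> 0 <= p%:~R :> R.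
Proof. by rewrite ler0z; lia. Qed.

(* The difference z = p + q eta has a conjugate p - q (beta - 1) of modulus less
   than beta - 1, so if q != 0 then p is nonzero of the same sign and z leaves
   [l, l + 1). When w may exceed conj_hi one only gets p >= 0 for q > 0, but
   then z < 0 is known. *)
Lemma nb_val_small (R : realType) (beta z : R) (a b a' b' : int) :
  1 < beta -> nb_domain beta z (nb_conj beta a' b') ->
  conj_lo beta <= nb_conj beta a b < conj_hi beta ->
  nb_val beta a b = nb_val beta a' b' + z -> z = 0.
Proof.
move=> b1 []; rewrite /conj_hi; move: (conj_lo beta) => lo.
rewrite nb_lE // => z_itv w'_itv zw' w_itv vz.
have [c0 c2 cg g1 _] := beta_inv_facts b1.
move: z_itv w'_itv zw' w_itv vz; rewrite /nb_conj /nb_val.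
have -> : a = a' + (a - a') by lia.
have -> : b = b' + (b - b') by lia.
move: (a - a') (b - b') => p q; rewrite !intrD.
move: (beta + 1)^-1 beta^-1 c0 c2 cg g1 => c g c0 c2 cg g1.
move=> z_itv w'_itv zw' w_itv vz.
have {}vz : z = p%:~R + q%:~R * (1 - g) by lra.
have [q1|q1|q0] := ltrgtP q 0.
- have qR := intr_leN1 R q1.
  have p0 : p < 0 by rewrite -(ltr_int R); nra.
  have pR := intr_leN1 R p0.
  by nra.
- have qR := intr_ge1 R q1.
  have [zt|zt] := ltP (c - g) z.
    have := zw' zt => {}zw'.
    have p0 : 0 < p by rewrite -(ltr_int R); nra.
    have pR := intr_ge1 R p0.
    by nra.
  have p0 : -1 < p by rewrite -(ltr_int R) -[(-1)%:~R]/(-1); nra.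
  have pR := intr_ge0 R p0.
  by nra.
- move: vz; rewrite q0 mul0r addr0 => vz.
  have p1 : p < 1 by rewrite -(ltr_int R); lra.
  have p2 : -1 < p by rewrite -(ltr_int R) -[(-1)%:~R]/(-1); lra.
  by rewrite vz (_ : p = 0) //; clear -p1 p2; lia.
Qed.

(** * The (-beta)-integers described by the window *)

Lemma exists_expr_gt (R : realType) (beta x : R) : 2 <= beta ->
  exists k : nat, x < beta ^+ k.
Proof.
move=> b2; exists (Num.bound x).
apply: lt_le_trans (upper_nthrootP (leqnn _)) _.
by rewrite lerXn2r ?nnegrE; lra.
Qed.

Lemma floor_opp_nb_l (R : realType) (beta : R) :
  1 < beta -> Num.floor (- nb_l beta) = 0.
Proof.
move=> b1; apply: floor_def; rewrite nb_lE //.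
by have [c0 c2 _ _ _] := beta_inv_facts b1; lra.
Qed.

Lemma nb_T0 (R : realType) (beta : R) : 1 < beta -> nb_T beta 0 = 0.
Proof.
by move=> b1; rewrite /nb_T mulr0 !add0r floor_opp_nb_l // mulr0z oppr0.
Qed.

(** With zero digits T is multiplication by -beta, so a nonzero T^k(y) would leave the bounded
    interval; conversely 0 is a fixed point with digit 0. *)
Lemma nb_digits0P (R : realType) (beta y : R) (k : nat) : 2 <= beta ->
  nb_l beta < y < nb_l beta + 1 ->
  (forall i : nat, (k < i)%N -> nb_digit beta y i = 0) <->
  iter k (nb_T beta) y = 0.
Proof.
move=> b2 y_itv; have b1 : 1 < beta by lra.
split=> [dig|Tk i ki]; last first.
  case: i ki => // i; rewrite ltnS /nb_digit /= => ki.
  rewrite -(subnK ki) iterD Tk (_ : iter _ _ 0 = 0).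
    by rewrite mulr0 add0r floor_opp_nb_l.
  by elim: (i - k)%N => //= n ->; exact: nb_T0.
have it n : iter (n + k) (nb_T beta) y = (- beta) ^+ n * iter k (nb_T beta) y.
  elim: n => [|n IH]; first by rewrite expr0 mul1r.
  rewrite addSn iterS {1}/nb_T.
  have := dig (n + k).+1; rewrite /nb_digit /= => -> //; last first.
    by rewrite ltnS leq_addl.
  by rewrite subr0 IH exprS mulrA.
apply/eqP; apply: contraT => z0; set z := iter k _ y in it z0.
have [n nz] := exists_expr_gt `|z|^-1 b2.
have z_gt0 : 0 < `|z| by rewrite normr_gt0.
have : `|iter (n + k) (nb_T beta) y| < 1.
  have [c0 c2 _ _ _] := beta_inv_facts b1; rewrite ltr_norml.
  case: (n + k)%N => [|j]; last have := nb_T_itv beta (iter j (nb_T beta) y).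
    by move: y_itv; rewrite /= nb_lE //; lra.
  by rewrite /= nb_lE //; lra.
rewrite it normrM normrX normrN (gtr0_norm (_ : 0 < beta)); last by lra.
by rewrite -ltr_pdivlMr // div1r => /lt_trans/(_ nz); rewrite ltxx.
Qed.

Definition nb_q (R : realType) (beta : R) (p : int) : int :=
  Num.floor (p%:~R / (beta - 1) + (beta + 1)^-1).

(** As 2/(beta+1) - 1 = -(beta-1)/(beta+1), dividing the window inequalities by beta - 1 turns them
    into those defining the floor. *)
Lemma nb_qP (R : realType) (beta : R) (p q : int) : 1 < beta ->
  conj_lo beta <= nb_conj beta p q < conj_hi beta <-> nb_q beta p = q.
Proof.
move=> b1; have [c0 c2 cg g1 [_ bc _]] := beta_inv_facts b1.
have pE : p%:~R = p%:~R / (beta - 1) * (beta - 1).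
  by rewrite divfK //; apply: lt0r_neq0; lra.
rewrite (rwP eqP) /nb_q floor_eq /nb_conj /conj_hi /conj_lo {1 2}pE intrD.
move: (p%:~R / (beta - 1)) => u.
have b0 : 0 < beta - 1 by lra.
have -> : 2 * (beta + 1)^-1 - 1 = - (beta + 1)^-1 * (beta - 1) by lra.
have -> : - (beta + 1)^-1 * (beta - 1) + (beta - 1) =
  (1 - (beta + 1)^-1) * (beta - 1) by ring.
rewrite -mulrBl ler_pM2r // ltr_pM2r //.
by split=> /andP[? ?]; apply/andP; split; lra.
Qed.

Lemma nb_integersE (R : realType) (m : int) (beta : R) :
  2 <= beta -> beta + beta^-1 = m%:~R ->
  nb_integers beta = range (fun p => nb_val beta p (nb_q beta p)).
Proof.
move=> b2 bm; have b1 : 1 < beta by lra.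
have b0 : beta != 0 by apply: lt0r_neq0; lra.
have xE x k : (- beta) ^+ k * (x / (- beta) ^+ k) = x.
  by rewrite mulrCA divff ?mulr1 // expf_neq0 // oppr_eq0.
apply/seteqP; split=> [x [k [x_itv /(nb_digits0P _ b2 x_itv) Tk]]|_ [p _ <-]].
  have [a [b [xab]]] := nb_orbit k b1 bm x_itv.
  rewrite Tk => -[_ w_itv] w_hi; exists a => //.
  rewrite (_ : nb_q beta a = b) ?xE //; last first.
    apply/nb_qP => //; have [_ _ cg _ _] := beta_inv_facts b1.
    (* The point T^k = 0 exceeds 1/(beta+1) - 1/beta, so the sharp upper bound applies. *)
    by case/andP: w_itv => /ltW -> _; apply: w_hi; lra.
  by move: xab; rewrite xE Tk addr0.
set x := nb_val _ _ _; have [c0 c2 _ _ _] := beta_inv_facts b1.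
(* 1/(beta+1) is the distance from 0 to l + 1, the nearer endpoint. *)
have [k xk] := exists_expr_gt (`|x| / (beta + 1)^-1) b2.
have x_itv : nb_l beta < x / (- beta) ^+ k < nb_l beta + 1.
  have : `|x / (- beta) ^+ k| < (beta + 1)^-1.
    rewrite normrM normfV normrX normrN (gtr0_norm (_ : 0 < beta)); last lra.
    by rewrite ltr_pdivrMr ?exprn_gt0 // 1?mulrC -?ltr_pdivrMr //; lra.
  by rewrite ltr_norml nb_lE //; lra.
exists k; split=> //; apply/nb_digits0P => //.
have [a [b [xab dom]]] := nb_orbit k b1 bm x_itv.
apply: (nb_val_small b1 dom (iffRL (nb_qP p _ b1) (erefl _))).
by rewrite -xab xE.
Qed.

(** * Uniqueness of increasing enumerations *)

Lemma incr_lt (R : numDomainType) (t : int -> R) :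
  (forall j, t j < t (j + 1)) -> {homo t : i j / i < j}.
Proof.
move=> tlt i j ij; have -> : j = i + (`|j - i|.-1)%:Z + 1 by lia.
elim: (`|j - i|.-1) => [|n IH]; first by rewrite addr0.
by apply: lt_trans IH _; rewrite (_ : i + n.+1%:Z = i + n%:Z + 1) //; lia.
Qed.

(** Immediate successors in the common range coincide, so agreement spreads from 0 in both
    directions. *)
Lemma incr_range_eq (R : realDomainType) (s t : int -> R) :
  (forall j, s j < s (j + 1)) -> (forall j, t j < t (j + 1)) ->
  range s = range t -> s 0 = t 0 -> s = t.
Proof.
move=> slt tlt st s0.
have sm := incr_lt slt; have tm := incr_lt tlt.
have tlW : {mono t : i j / i < j}.
  exact/leW_mono/le_mono.
have f j : exists i, t i = s j.
  by have : range t (s j) by [rewrite -st; exists j]; case=> i _; exists i.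
have g j : exists i, s i = t j.
  by have : range s (t j) by [rewrite st; exists j]; case=> i _; exists i.
have up j i : s j = t i -> s (j + 1) = t (i + 1).
  move=> e; have [i' ti'] := f (j + 1).
  have : i < i' by rewrite -tlW -e ti'.
  (* Otherwise t (i + 1) would be a value of [s] strictly between s j and s (j + 1). *)
  rewrite -lezD1 le_eqVlt => /orP[/eqP-> //|ii'].
  have [j' sj'] := g (i + 1).
  have slW : {mono s : i j / i < j} by exact/leW_mono/le_mono.
  have : j < j' by rewrite -slW e sj'.
  have : j' < j + 1 by rewrite -slW sj' -ti' tlW.
  by lia.
have dn j i : s (j + 1) = t (i + 1) -> s j = t i.
  move=> e; have [i' ti'] := f j.
  have ii' : i' < i + 1 by rewrite -tlW ti' -e.
  have := up _ _ (esym ti'); rewrite e => /eqP; rewrite eq_le.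
  rewrite !(le_mono tm) => h.
  by rewrite -ti'; congr t; lia.
apply/funext; elim=> [//|n IH|n IH].
  by rewrite -addn1 PoszD; exact: up.
by apply: dn; rewrite (_ : - n.+1%:Z + 1 = - n%:Z) //; lia.
Qed.

(** * Monotonicity and near-additivity of the rounding *)

Lemma nb_q_lt (R : realType) (beta : R) (p : int) : 1 < beta ->
  nb_val beta p (nb_q beta p) < nb_val beta (p + 1) (nb_q beta (p + 1)).
Proof.
move=> b1; have [_ _ _ g1 _] := beta_inv_facts b1.
have : (nb_q beta p <= nb_q beta (p + 1)).
  apply: le_floor; rewrite lerD2r ler_pM2r ?invr_gt0; last lra.
  by rewrite ler_int; lia.
by rewrite /nb_val intrD -(ler_int R); nra.
Qed.

Lemma nb_q0 (R : realType) (beta : R) : 1 < beta -> nb_q beta 0 = 0.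
Proof.
move=> b1; apply: floor_def; rewrite mul0r add0r.
by have [c0 c2 _ _ _] := beta_inv_facts b1; lra.
Qed.

(** Before rounding, the combinations equal 1/(beta+1) and -1/(beta+1); the three fractional parts
    keep each integer strictly between -2 and 2. *)
Lemma nb_q_quasiD (R : realType) (beta : R) (j k : int) : 1 < beta ->
  `|nb_q beta j + nb_q beta k - nb_q beta (j + k)| <= 1 /\
  `|nb_q beta j - nb_q beta k - nb_q beta (j - k)| <= 1.
Proof.
move=> b1; have [c0 c2 _ _ _] := beta_inv_facts b1.
have qlt (p : int) := floor_itv (p%:~R / (beta - 1) + (beta + 1)^-1).
have := qlt (j - k); have := qlt (j + k); have := qlt k; have := qlt j.
rewrite -!/(nb_q beta _) !intrD intrN mulrBl mulrDl => h1 h2 h3 h4.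
split; rewrite ler_norml -!ltzD1 -!(ltr_int R) !(intrD, intrN); lra.
Qed.

Theorem corollary5p4 (R : realType) (m : int) (beta : R) (t : int -> R)
  (hm : 3 <= m)
  (hbeta1 : 1 < beta)
  (hbeta : root ('X^2 - m%:~R *: 'X + 1) beta)
  (ht : range t = nb_integers beta)
  (ht0 : t 0 = 0)
  (htlt : forall j : int, t j < t (j + 1)) :
  let eta := 1 - 1 / beta in
  forall j k : int,
    [set t (j + k) + e | e in [set - eta; 0; eta]] (t j + t k) /\
    [set t (j - k) + e | e in [set - eta; 0; eta]] (t j - t k).
Proof.
move=> eta j k.
have b0 : beta != 0 by apply: lt0r_neq0; lra.
have bm : beta + beta^-1 = m%:~R.
  move: hbeta; rewrite rootE !hornerE => /eqP h.
  apply: (mulIf b0); rewrite mulrDl mulVf //; lra.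
have mR : 3 <= m%:~R :> R by rewrite -[3]/(3%:~R) ler_int.
have [_ _ _ g1 _] := beta_inv_facts hbeta1.
(* Because beta + 1/beta >= 3 and 1/beta < 1. *)
have b2 : 2 <= beta by lra.
have tE : t = fun p => nb_val beta p (nb_q beta p).
  apply: incr_range_eq => //; first by move=> p; exact: nb_q_lt.
    by rewrite ht; exact: nb_integersE bm.
  by rewrite ht0 nb_q0 // /nb_val mulr0z mul0r addr0.
have shift (x : R) (p d : int) : `|d| <= 1 -> x = t p + d%:~R * eta ->
    [set t p + e | e in [set - eta; 0; eta]] x.
  move=> d1 ->; exists (d%:~R * eta) => //.
  have [->|[->|->]] : d = -1 \/ d = 0 \/ d = 1 by lia.
  - by left; left; rewrite /= mulrN1z mulN1r.
  - by left; right; rewrite /= mulr0z mul0r.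
  - by right; rewrite /= mulr1z mul1r.
have [qD qB] := nb_q_quasiD j k hbeta1.
split; [apply: (shift _ _ _ qD)|apply: (shift _ _ _ qB)].
(* The integer coordinates cancel, leaving only the defect of [nb_q] times eta. *)
all: rewrite tE /nb_val /eta div1r !(intrD, intrN); ring.
Qed.
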